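(* Let $G$ be an embedded graph and let $\vec{s}$ be an arrow marked graph state of the embedded medial graph $G_m$. Then $((G_m)_{\vec{s}})_m\cong G_m$ as abstract graphs; i.e. $$\mathrm{Orb}(G)=\{H \mid H_m\cong G_m\},$$ where $H$ ranges over embedded graphs.
   Context: Embedded graphs. An embedded graph is a finite graph (loops and multiple edges allowed) cellularly embedded in a closed, possibly non-orientable, surface. Equivalently, it is a ribbon graph: a surface with boundary that is a union of vertex discs and edge discs, meeting in disjoint line segments, each segment on the boundary of exactly one vertex disc and one edge disc, each edge disc containing exactly two segments. Equivalently, it is an arrow presentation: a set of circles with disjoint labelled arrows on them, each label appearing on exactly two arrows, up to relabelling pairs and reversing both arrows of a given label. Circles correspond to vertex discs; for each label $e$ an edge disc is attached by orienting its boundary, choosing two disjoint boundary arcs directed accordingly, and identifying these with the two $e$-labelled arrows respecting directions. Embedded graphs are considered up to isomorphism (homeomorphism preserving the vertex-edge structure). The symbol $\cong$ denotes isomorphism of underlying abstract graphs. Twisted duality. For an edge $e$ of $G$ (given as an arrow presentation): the half-twist $G^{\tau(e)}$ is obtained by reversing exactly one of the two $e$-labelled arrows; the dual with respect to $e$, $G^{\delta(e)}$, is obtained as follows: if $A,B$ are the two $e$-labelled arrows, add a segment with an $e$-labelled arrow directed from the head of $A$ to the tail of $B$, and a segment with an $e$-labelled arrow directed from the head of $B$ to the tail of $A$, and delete $A$ and $B$ together with the arcs containing them. These satisfy $\tau^2=\delta^2=(\tau\delta)^3=1$ on each edge, operations on different edges commute, and words act by $G^{\xi\zeta(e)}=(G^{\zeta(e)})^{\xi(e)}$;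 so $\mathfrak{G}=\langle\delta,\tau\mid\delta^2,\tau^2,(\tau\delta)^3\rangle\cong S_3$ acts at each edge. $H$ is a twisted dual of $G$ if it is obtained from $G$ by applying some element of $\mathfrak{G}$ at each edge. $\mathrm{Orb}(G)$ is the set of all twisted duals of $G$. Medial graphs. The medial graph $G_m$ of a cellularly embedded graph $G$ is the 4-regular embedded graph in the same surface with a vertex $v_e$ of degree 4 on each edge $e$ of $G$ and edges drawn by following the face boundaries of $G$. By convention an isolated vertex of $G$ gives an ''isolated face'' (a vertexless closed curve) in $G_m$, which is carried along as an arrowless circle in every graph state and is retained as part of the abstract graph. Cycle family graphs. Let $F$ be a 4-regular embedded graph. A vertex state at $v$ is a choice of one of the three pairings of the four half-edges at $v$, where $v$ is replaced by two arcs joining the paired half-edges. An arrow marked vertex state is a vertex state with one $v$-labelled arrow on each of the two arcs, each pointing in either direction. An arrow marked graph state $\vec{s}$ is a choice of arrow marked vertex state at each vertex. The resulting closed curves with their arrows form an arrow presentation, whose embedded graph is denoted $F_{\vec{s}}$. *)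

(* Defs.v *)
From mathcomp Require Import all_boot.

Set Implicit Arguments.
Unset Strict Implicit.
Unset Printing Implicit Defensive.

(** * Embedded graphs, as arrow presentations *)

(* The two arrows labelled [e] are named [(e, false)] and [(e, true)].  The end
   [(e, a, h)] is the head of the arrow [(e, a)] if [h], and its tail otherwise. *)
Definition arrow_end (E : finType) := (E * bool * bool)%type.

(* Removing the open arrows from the circles that carry at least one of them
   leaves arcs, each joining two arrow ends; [arc_mate] exchanges the two ends of
   such an arc.  The circles are recovered by putting the arrows back, and every
   fixed-point free involution on the arrow ends arises in this way.  The
   circles carrying no arrow (the isolated vertices) are counted by [circles].
   The graph need not be connected. *)
Record arrow_presentation (E : finType) := ArrowPresentation {
  arc_mate : arrow_end E -> arrow_end E;
  arc_mateK : involutive arc_mate;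
  arc_mate_neq : forall x, arc_mate x != x;
  circles : nat
}.

(* Isomorphism: a bijection [f] of the labels; for each label, the names of its
   two arrows may be exchanged ([swap]) and both of them reversed ([rev]).
   Circles are neither ordered nor oriented. *)
Definition ap_iso (E E' : finType)
    (G : arrow_presentation E) (H : arrow_presentation E') : Prop :=
  exists (f : E -> E') (swap rev : E -> bool),
    let phi (x : arrow_end E) : arrow_end E' :=
      let: (e, a, h) := x in (f e, a (+) swap e, h (+) rev e) in
    [/\ bijective f,
        forall x, arc_mate H (phi x) = phi (arc_mate G x)
      & circles H = circles G].

(** * Twisted duality *)

Section Relabel.
Variables (E : finType) (f : arrow_end E -> arrow_end E) (f_inj : injective f).
Variable G : arrow_presentation E.

Definition relabel_arc (x : arrow_end E) := f (arc_mate G (invF f_inj x)).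

Lemma relabel_arcK : involutive relabel_arc.
Proof. by move=> x; rewrite /relabel_arc invF_f arc_mateK f_invF. Qed.

Lemma relabel_arc_neq x : relabel_arc x != x.
Proof. by rewrite /relabel_arc -{2}(f_invF f_inj x) inj_eq // arc_mate_neq. Qed.

(* The points that are the ends of the arrows stay where they are, but the end
   called [x] is now called [f x], which may alter which ends form an arrow. *)
Definition relabel : arrow_presentation E :=
  ArrowPresentation relabel_arcK relabel_arc_neq (circles G).
End Relabel.

Section EdgeOperations.
Variables (E : finType) (e : E).

Definition tau_end (x : arrow_end E) : arrow_end E :=
  let: (e', a, h) := x in
  if (e' == e) && ~~ a then (e', a, ~~ h) else x.

(* The new [e]-labelled arrow [(e, a)] runs from the head of the old arrow
   [(e, a)] to the tail of the old arrow [(e, ~~ a)]. *)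
Definition delta_end (x : arrow_end E) : arrow_end E :=
  let: (e', a, h) := x in
  if e' == e then (if h then (e', a, false) else (e', ~~ a, true)) else x.

Lemma tau_end_inj : injective tau_end.
Proof.
apply: (can_inj (g := tau_end)) => -[[e' a] h] /=.
by case: (boolP ((e' == e) && ~~ a)) => H /=; rewrite ?H ?(negbTE H) ?negbK.
Qed.

Lemma delta_end_inj : injective delta_end.
Proof.
move=> [[e1 a1] h1] [[e2 a2] h2] /=.
case: eqP => [->|ne1]; case: eqP => [->|ne2] //.
- by case: h1 h2 a1 a2 => [] [] [] [].
- by case: h1 => -[] E2; case: ne2.
- by case: h2 => -[] E1; case: ne1.
Qed.

Definition half_twist (G : arrow_presentation E) := relabel tau_end_inj G.
Definition edge_dual (G : arrow_presentation E) := relabel delta_end_inj G.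
End EdgeOperations.

Inductive edge_op := Tau | Delta.

(* An element of <delta, tau | delta^2, tau^2, (tau delta)^3>, written as a word
   in the generators, which are involutions.  Words that represent the same
   element act in the same way up to [ap_iso]. *)
Definition edge_word := seq edge_op.

Definition apply_op (E : finType) (e : E) (o : edge_op)
    (G : arrow_presentation E) : arrow_presentation E :=
  match o with Tau => half_twist e G | Delta => edge_dual e G end.

(* The last letter acts first: G^{(xi zeta)(e)} = (G^{zeta(e)})^{xi(e)}. *)
Definition apply_word (E : finType) (e : E) (w : edge_word)
    (G : arrow_presentation E) : arrow_presentation E :=
  foldr (apply_op e) G w.

(* Operations on different edges commute, so the order of [enum E] is
   immaterial. *)
Definition twist (E : finType) (w : E -> edge_word)
    (G : arrow_presentation E) : arrow_presentation E :=
  foldr (fun e => apply_word e (w e)) G (enum E).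

Definition Orb (E : finType) (G : arrow_presentation E)
    (E' : finType) (H : arrow_presentation E') : Prop :=
  exists w : E -> edge_word, ap_iso (twist w G) H.

(** * 4-regular embedded graphs, as signed rotation systems *)

(* For a local orientation and a first half-edge chosen at [v], the half-edges
   met when turning around [v] are
   (v,false,false), (v,false,true), (v,true,false), (v,true,true). *)
Definition half_edge (V : finType) := (V * bool * bool)%type.

Definition next_half (V : finType) (x : half_edge V) : half_edge V :=
  let: (v, i, j) := x in (v, i (+) j, ~~ j).

(* [opp] exchanges the two halves of each edge; [twisted] tells whether the
   ribbon of the edge reverses the local orientations chosen at its ends;
   [curves] counts the vertexless closed curves ("isolated faces"). *)
Record embedded4 (V : finType) := Embedded4 {
  opp : half_edge V -> half_edge V;
  oppK : involutive opp;
  opp_neq : forall x, opp x != x;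
  twisted : half_edge V -> bool;
  twisted_opp : forall x, twisted (opp x) = twisted x;
  curves : nat
}.

(** * Medial graphs *)

Section Medial.
Variables (E : finType) (G : arrow_presentation E).

(* Going around the boundary of the edge disc of [e] in the direction of its
   arrows, one meets its corners in the order tail and head of [(e, false)],
   tail and head of [(e, true)].  The medial vertex v_e lies in this disc and
   has one half-edge towards each corner; a medial edge follows an arc of a
   vertex circle, i.e. a piece of face boundary, from a corner to the next. The
   boundary orientations of the edge discs at the ends of the arc agree along it
   exactly when one end is a head and the other one a tail. *)
Definition medial_twisted (x : half_edge E) : bool := x.2 == (arc_mate G x).2.

Lemma medial_twisted_opp x : medial_twisted (arc_mate G x) = medial_twisted x.
Proof. by rewrite /medial_twisted arc_mateK eq_sym. Qed.

Definition medial : embedded4 E :=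
  Embedded4 (@arc_mateK _ G) (@arc_mate_neq _ G) medial_twisted_opp (circles G).
End Medial.

(** * Underlying abstract graphs *)

(* Loops and multiple edges are allowed; [ends e] is a singleton if [e] is a
   loop.  Vertexless closed curves are part of the graph. *)
Record abstract_graph := AbstractGraph {
  vertex : finType;
  edge : finType;
  ends : edge -> {set vertex};
  ends_card : forall e, 0 < #|ends e| <= 2;
  closed_curves : nat
}.

Definition graph_iso (A B : abstract_graph) : Prop :=
  exists (f : vertex A -> vertex B) (g : edge A -> edge B),
    [/\ bijective f, bijective g,
        forall e, ends (g e) = f @: ends e
      & closed_curves A = closed_curves B].

Section Underlying.
Variables (V : finType) (F : embedded4 V).

Definition edge_sets : {set {set half_edge V}} :=
  [set [set x; opp F x] | x : half_edge V].

Definition edge_ends (e : {e : {set half_edge V} | e \in edge_sets}) : {set V} :=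
  [set x.1.1 | x in val e].

Lemma edge_ends_card e : 0 < #|edge_ends e| <= 2.
Proof.
case: e => e /= e_edge; rewrite /edge_ends /=.
case/imsetP: e_edge => x _ ->; apply/andP; split.
  by apply/card_gt0P; exists x.1.1; apply/imsetP; exists x; rewrite // set21.
by apply: leq_trans (leq_imset_card _ _) _; rewrite cards2; case: (_ != _).
Qed.

Definition underlying : abstract_graph :=
  AbstractGraph edge_ends_card (curves F).
End Underlying.

(** * Arrow marked graph states and cycle family graphs *)

(* The three pairings of the half-edges 0, 1, 2, 3 (in cyclic order) at a
   vertex: 01|23, 12|30 and 02|13. *)
Inductive vertex_state := Pair01_23 | Pair12_30 | Pair02_13.

(* A vertex state has two arcs, named by a boolean, each of which carries an
   arrow; [flipped a] tells that the arrow on the arc [a] points from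
   [arc_second] to [arc_first], rather than from [arc_first] to [arc_second]. *)
Record marked_vertex_state := MarkedVertexState {
  pairing : vertex_state;
  flipped : bool -> bool
}.

Definition arc_first (V : finType) (t : vertex_state) (v : V) (a : bool)
    : half_edge V :=
  match t with
  | Pair01_23 => (v, a, false)
  | Pair12_30 => (v, a, true)
  | Pair02_13 => (v, false, a)
  end.

Definition arc_second (V : finType) (t : vertex_state) (v : V) (a : bool)
    : half_edge V :=
  let x := arc_first t v a in
  match t with
  | Pair01_23 | Pair12_30 => next_half x
  | Pair02_13 => next_half (next_half x)
  end.

Definition marked_graph_state (V : finType) := V -> marked_vertex_state.

Section CycleFamily.
Variables (V : finType) (F : embedded4 V) (s : marked_graph_state V).

(* The half-edge of [F] reached from an arrow end, moving away from the arrow. *)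
Definition arrow_half_edge (x : arrow_end V) : half_edge V :=
  let: (v, a, h) := x in
  if h (+) flipped (s v) a then arc_second (pairing (s v)) v a
  else arc_first (pairing (s v)) v a.

Lemma arrow_half_edge_inj : injective arrow_half_edge.
Proof.
have vE x : (arrow_half_edge x).1.1 = x.1.1.
  case: x => [[v a] h]; rewrite /arrow_half_edge /arc_second /arc_first /next_half.
  by case: (pairing _); case: ifP.
move=> x y xy; have := vE x; rewrite xy vE; move: xy.
case: x y => [[v a] h] [[v' a'] h'] /= xy Ev; move: xy; rewrite {}Ev.
rewrite /arc_second /arc_first /next_half.
case: (s v) => -[] fl /=; case: a a' h h' => [] [] [] [] //=;
  by case: (fl true); case: (fl false).
Qed.

Definition state_arc (x : arrow_end V) : arrow_end V :=
  invF arrow_half_edge_inj (opp F (arrow_half_edge x)).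

Lemma state_arcK : involutive state_arc.
Proof. by move=> x; rewrite /state_arc f_invF oppK invF_f. Qed.

Lemma state_arc_neq x : state_arc x != x.
Proof.
by rewrite -(inj_eq arrow_half_edge_inj) /state_arc f_invF opp_neq.
Qed.

Definition state_graph : arrow_presentation V :=
  ArrowPresentation state_arcK state_arc_neq (curves F).
End CycleFamily.

(* Main.v *)
Require Import Defs.
From mathcomp Require Import all_boot.

Set Implicit Arguments.
Unset Strict Implicit.
Unset Printing Implicit Defensive.

(** Up to its embedding and its vertexless curves, the medial graph of [G] is the
    fixed-point free involution [arc_mate G] on the arrow ends, fibred over the
    labels in fibres of size four.  An isomorphism of underlying abstract
    graphs lifts to a bijection of half-edges that respects the fibres and the
    involutions ([graph_isoP]), and nothing else: the cyclic order at a vertex and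
    the twisting of the ribbons are forgotten, so inside each fibre the
    bijection is an arbitrary permutation.

    A marked graph state merely renames the four half-edges of each vertex, so
    passing to the state graph and back to its medial graph is such a bijection
    ([medial_state_graph]); this gives the first claim.

    For the second claim, identify a fibre with the plane F_2^2 through the
    coordinates (arrow, end).  Isomorphisms of arrow presentations act on a
    fibre by the translations of the plane, and the half-twist and the partial
    dual act by affine maps whose linear parts are the two elementary
    transvections.  These generate GL_2(F_2), and every permutation of F_2^2 is
    affine (S_4 = AGL_2(F_2)), so twisted duality and isomorphism together
    realise all permutations in all fibres ([perm_affine], [OrbP]).  Hence the
    orbit of [G] consists exactly of the arrow presentations whose medial graph
    is that of [G]. *)

(** * Abstract isomorphism lifts to half-edges *)

Definition half_edge_iso (V V' : finType) (F : embedded4 V) (F' : embedded4 V')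
    : Prop :=
  exists (f : V -> V') (phi : half_edge V -> half_edge V'),
    [/\ bijective f, bijective phi, forall x, (phi x).1.1 = f x.1.1,
        {morph phi : x / opp F x >-> opp F' x}
      & curves F = curves F'].

Lemma half_edge_iso_sym (V V' : finType) (F : embedded4 V) (F' : embedded4 V') :
  half_edge_iso F F' -> half_edge_iso F' F.
Proof.
case=> f [phi [[f' fK f'K] [phi' phiK phi'K] phi1 phiM cFF']].
exists f', phi'; split=> //; first by exists f.
- by exists phi.
- by move=> x; rewrite -{2}(phi'K x) phi1 fK.
- by move=> x; rewrite -{1}(phi'K x) -phiM phiK.
Qed.

Section EdgeOf.
Variables (V : finType) (F : embedded4 V).

Lemma edge_of_subproof x : [set x; opp F x] \in edge_sets F.
Proof. by apply/imsetP; exists x. Qed.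

Definition edge_of (x : half_edge V) : edge (underlying F) :=
  exist _ [set x; opp F x] (edge_of_subproof x).

Lemma edge_of_opp x : edge_of (opp F x) = edge_of x.
Proof. by apply: val_inj; rewrite /= oppK setUC. Qed.

Lemma edge_of_eq x y : edge_of x = edge_of y -> x = y \/ x = opp F y.
Proof.
by case/(congr1 val)/setP/(_ x); rewrite /= !inE eqxx /= => /esym/orP[]/eqP;
  [left | right].
Qed.

Lemma ends_edge_of x : ends (edge_of x) = [set x.1.1; (opp F x).1.1].
Proof. by rewrite /= /edge_ends /= imsetU !imset_set1. Qed.

Lemma edge_of_section :
  exists r : edge (underlying F) -> half_edge V, cancel r edge_of.
Proof.
apply: (fin_all_exists (P := fun e x => edge_of x = e)) => -[e e_edge].
by case/imsetP: (e_edge) => x _ De; exists x; apply: val_inj.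
Qed.
End EdgeOf.
Arguments edge_of {V} F x.

Lemma set2_cancel (T : finType) (a b c : T) : [set a; b] = [set a; c] -> b = c.
Proof.
move/setP=> E; have := E b; have := E c; rewrite !inE !eqxx !orbT.
by move=> /orP[/eqP->|/eqP->//] /esym; rewrite orbb => /eqP.
Qed.

Lemma edge_map (V V' : finType) (F : embedded4 V) (F' : embedded4 V')
    (phi : half_edge V -> half_edge V') :
    {morph phi : x / opp F x >-> opp F' x} ->
  exists g, forall x, g (edge_of F x) = edge_of F' (phi x).
Proof.
move=> phiM; have [r rK] := edge_of_section F.
exists (fun e => edge_of F' (phi (r e))) => x.
case: (edge_of_eq (rK (edge_of F x))) => -> //.
by rewrite phiM edge_of_opp.
Qed.

Section LiftEdges.
Variables (V V' : finType) (F : embedded4 V) (F' : embedded4 V').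

(** The only choice in the lift is at a loop, whose two half-edges can be
    matched in either way; it is made by fixing one half [r e] of each edge. *)
Lemma half_edge_lift (f : V -> V')
    (g : edge (underlying F) -> edge (underlying F')) :
    (forall e, ends (g e) = f @: ends e :> {set V'}) ->
  exists phi : half_edge V -> half_edge V',
    [/\ forall x, edge_of F' (phi x) = g (edge_of F x),
        forall x, (phi x).1.1 = f x.1.1
      & {morph phi : x / opp F x >-> opp F' x}].
Proof.
move=> ends_g; have [r rK] := edge_of_section F.
have /fin_all_exists[s sP] :
    forall e, exists y, edge_of F' y = g e /\ y.1.1 = f (r e).1.1.
  move=> e; have [r' r'K] := edge_of_section F'.
  have: f (r e).1.1 \in [set (r' (g e)).1.1; (opp F' (r' (g e))).1.1].
    rewrite -ends_edge_of r'K ends_g imset_f //.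
    by rewrite -{2}(rK e) ends_edge_of set21.
  case/set2P=> ->; first by exists (r' (g e)).
  by exists (opp F' (r' (g e))); rewrite edge_of_opp.
have s_opp e : (opp F' (s e)).1.1 = f (opp F (r e)).1.1.
  have [sg sr] := sP e; apply: (@set2_cancel _ (s e).1.1).
  rewrite -ends_edge_of sg ends_g -{1}(rK e) ends_edge_of.
  by rewrite imsetU !imset_set1 sr.
pose phi x := if x == r (edge_of F x) then s (edge_of F x)
              else opp F' (s (edge_of F x)).
have phi_r e : phi (r e) = s e by rewrite /phi rK eqxx.
have phi_opp e : phi (opp F (r e)) = opp F' (s e).
  by rewrite /phi edge_of_opp rK (negPf (opp_neq _ _)).
have half_ind (P : half_edge V -> Prop) :
    (forall e, P (r e)) -> (forall e, P (opp F (r e))) -> forall x, P x.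
  move=> Pr Popp x; have [->|->] := edge_of_eq (esym (rK (edge_of F x))) => //.
exists phi; split; apply: half_ind => e.
- by rewrite phi_r rK; case: (sP e).
- by rewrite phi_opp !edge_of_opp rK; case: (sP e).
- by rewrite phi_r; case: (sP e).
- by rewrite phi_opp s_opp.
- by rewrite phi_r phi_opp.
- by rewrite oppK phi_r phi_opp oppK.
Qed.

(** The lift of an isomorphism is injective because the two halves of an edge
    are exchanged by the involutions, which have no fixed point; it is then
    bijective by counting. *)
Lemma graph_isoP :
  graph_iso (underlying F) (underlying F') <-> half_edge_iso F F'.
Proof.
split=> [[f [g [bf bg ends_g cFF']]] | [f [phi [bf bphi phi1 phiM cFF']]]].
  have [phi [phig phi1 phiM]] := half_edge_lift ends_g.
  exists f, phi; split=> //; apply: inj_card_bij; last first.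
    by rewrite !card_prod (bij_eq_card bf).
  (* [x] and [y] lie on one edge, and if [x = opp F y] then [phi y] would be
     fixed by [opp F']. *)
  move=> x y Exy; have := phig x; rewrite Exy phig => /(bij_inj bg) /esym Eg.
  case: (edge_of_eq Eg) => // Dx; case/eqP: (opp_neq F' (phi y)).
  by rewrite -phiM -Dx.
have [phi' phiK phi'K] := bphi.
have phi'M : {morph phi' : x / opp F' x >-> opp F x}.
  by move=> x; rewrite -{1}(phi'K x) -phiM phiK.
have [[g gP] [g' g'P]] := (edge_map phiM, edge_map phi'M).
have [[r rK] [r' r'K]] := (edge_of_section F, edge_of_section F').
exists f, g; split=> // [|e].
  exists g' => e; first by rewrite -(rK e) gP g'P phiK.
  by rewrite -(r'K e) g'P gP phi'K.
by rewrite -(rK e) gP !ends_edge_of imsetU !imset_set1 -!phi1 phiM.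
Qed.
End LiftEdges.

(** * Cycle family graphs *)

(** The arcs of [state_graph F s] are by construction the edges of [F] read in
    the names that the state gives to the half-edges, so the renaming
    [arrow_half_edge] is the isomorphism. *)
Lemma medial_state_graph (V : finType) (F : embedded4 V)
    (s : marked_graph_state V) :
  half_edge_iso (medial (state_graph F s)) F.
Proof.
exists id, (arrow_half_edge s); split=> //; first by exists id.
- exact: injF_bij (@arrow_half_edge_inj _ s).
- case=> -[v a] h; rewrite /= /arc_second /arc_first /next_half.
  by case: (pairing _); case: ifP.
- by move=> x; rewrite /= /state_arc f_invF.
Qed.

(** * The action on one fibre *)

(** A pair (arrow, end) is a point of the plane F_2^2.  The linear parts of these two affine maps are the
    transvections (a, h) |-> (a, a + h) and (a, h) |-> (a + h, h). *)
Definition op_act (o : edge_op) (p : bool * bool) : bool * bool :=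
  match o with
  | Tau => (p.1, p.2 (+) ~~ p.1)
  | Delta => (p.1 (+) ~~ p.2, ~~ p.2)
  end.

Definition word_act (w : edge_word) (p : bool * bool) : bool * bool :=
  foldr op_act p w.

Definition translate (t p : bool * bool) : bool * bool :=
  (p.1 (+) t.1, p.2 (+) t.2).

(** A permutation of F_2^2 is affine: the differences with the image of the
    origin are the three nonzero vectors in some order, and GL_2(F_2) permutes
    these in all six ways.  The six words below represent its elements. *)
Lemma perm_affine (sigma : bool * bool -> bool * bool) : injective sigma ->
  exists w t, sigma =1 translate t \o word_act w.
Proof.
move=> sigma_inj.
have [w wP] : exists w, forall p,
    translate (word_act w (false, false)) (word_act w p)
      = translate (sigma (false, false)) (sigma p).
  have neq p q : p != q -> sigma p != sigma q by rewrite inj_eq.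
  have := neq (false, false) (false, true) isT.
  have := neq (false, false) (true, false) isT.
  have := neq (false, false) (true, true) isT.
  have := neq (false, true) (true, false) isT.
  have := neq (false, true) (true, true) isT.
  have := neq (true, false) (true, true) isT.
  case D00: (sigma (false, false)) => [[] []];
  case D01: (sigma (false, true)) => [[] []] //;
  case D10: (sigma (true, false)) => [[] []] //;
  case D11: (sigma (true, true)) => [[] []] // *;
  first [ exists [::]; by case=> -[] []; rewrite ?D00 ?D01 ?D10 ?D11
        | exists [:: Tau]; by case=> -[] []; rewrite ?D00 ?D01 ?D10 ?D11
        | exists [:: Delta]; by case=> -[] []; rewrite ?D00 ?D01 ?D10 ?D11
        | exists [:: Tau; Delta]; by case=> -[] []; rewrite ?D00 ?D01 ?D10 ?D11
        | exists [:: Delta; Tau]; by case=> -[] []; rewrite ?D00 ?D01 ?D10 ?D11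
        | exists [:: Tau; Delta; Tau];
            by case=> -[] []; rewrite ?D00 ?D01 ?D10 ?D11 ].
exists w, (translate (sigma (false, false)) (word_act w (false, false))) => p /=.
by move: (wP p); move: (word_act w p) (word_act w _) (sigma p) (sigma _);
  do 4!case=> -[] [].
Qed.

(** * Orbits under twisted duality *)

Definition fibrewise (V V' : finType) (f : V -> V')
    (sigma : V -> bool * bool -> bool * bool) (x : half_edge V) : half_edge V' :=
  let p := sigma x.1.1 (x.1.2, x.2) in (f x.1.1, p.1, p.2).

Lemma eq_fibrewise (V V' : finType) (f : V -> V') sigma sigma' :
  (forall v, sigma v =1 sigma' v) -> fibrewise f sigma =1 fibrewise f sigma'.
Proof. by move=> E x; rewrite /fibrewise E. Qed.

Lemma fibrewise_comp (V1 V2 V3 : finType) (g : V2 -> V3) (f : V1 -> V2)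
    tau sigma :
  fibrewise g tau \o fibrewise f sigma
    =1 fibrewise (g \o f) (fun v => tau (f v) \o sigma v).
Proof. by move=> x; rewrite /fibrewise /= -surjective_pairing. Qed.

(** Twists and isomorphisms both rename arrow ends so that arcs go to arcs; they
    differ in which permutations of the four ends of a label they allow. *)
Definition carries (E E' : finType) (phi : arrow_end E -> arrow_end E')
    (G : arrow_presentation E) (H : arrow_presentation E') : Prop :=
  {morph phi : x / arc_mate G x >-> arc_mate H x} /\ circles G = circles H.

Lemma eq_carries (E E' : finType) (phi psi : arrow_end E -> arrow_end E') G H :
  phi =1 psi -> carries phi G H -> carries psi G H.
Proof. by move=> Epsi [phiM cGH]; split=> // x; rewrite -!Epsi phiM. Qed.

Lemma carries_comp (E1 E2 E3 : finType) (psi : arrow_end E2 -> arrow_end E3)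
    (phi : arrow_end E1 -> arrow_end E2) G1 G2 G3 :
  carries psi G2 G3 -> carries phi G1 G2 -> carries (psi \o phi) G1 G3.
Proof.
move=> [psiM c23] [phiM c12]; split; last by rewrite c12.
by move=> x /=; rewrite phiM psiM.
Qed.

Lemma relabel_carries (E : finType) (f : arrow_end E -> arrow_end E)
    (f_inj : injective f) G :
  carries f G (relabel f_inj G).
Proof. by split=> // x; rewrite /= /relabel_arc invF_f. Qed.

Section Twist.
Variable E : finType.
Implicit Types (G : arrow_presentation E) (e : E).

Lemma apply_word_carries e w G :
  carries (fibrewise id (fun v => if v == e then word_act w else id))
    G (apply_word e w G).
Proof.
elim: w => [|o w IHw].
  by split=> //= x; rewrite /fibrewise /= !if_same /= -!surjective_pairing.
have step : carries (fibrewise id (fun v => if v == e then op_act o else id))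
    (apply_word e w G) (apply_word e (o :: w) G).
  case: o => /=; apply: eq_carries (relabel_carries _ _) => -[[v a] h];
    rewrite /fibrewise /=; case: eqP => //= _; last by case: h; case: a.
  by case: a; rewrite ?addbF ?addbT.
apply: eq_carries (carries_comp step IHw) => x.
by rewrite fibrewise_comp; apply: eq_fibrewise => v p /=; case: eqP.
Qed.

(** Operations at different edges act on different fibres, so the fold over the
    edges acts on the fibre of [e] by the word [w e] alone. *)
Lemma twist_carries (w : E -> edge_word) G :
  carries (fibrewise id (fun e => word_act (w e))) G (twist w G).
Proof.
have partial_twist (s : seq E) : uniq s ->
    carries (fibrewise id (fun v => if v \in s then word_act (w v) else id))
      G (foldr (fun e => apply_word e (w e)) G s).
  elim: s => [_|e s IHs /= /andP[s'e /IHs{}IHs]].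
    by split=> //= x; rewrite /fibrewise /= -!surjective_pairing.
  apply: eq_carries (carries_comp (apply_word_carries e (w e) _) IHs) => x.
  rewrite fibrewise_comp; apply: eq_fibrewise => v p /=; rewrite inE.
  by case: eqP => [->|//]; rewrite (negPf s'e).
apply: eq_carries (partial_twist _ (enum_uniq E)).
by apply: eq_fibrewise => v; rewrite mem_enum.
Qed.

(** Exchanging the two arrows of a label and reversing both of them are the
    translations by the two coordinate vectors. *)
Lemma ap_isoP (E' : finType) G (H : arrow_presentation E') :
  ap_iso G H <-> exists (f : E -> E') (t : E -> bool * bool),
    bijective f /\ carries (fibrewise f (fun e => translate (t e))) G H.
Proof.
split=> [[f [swap [rev [bf fM cGH]]]] | [f [t [bf [fM cGH]]]]].
  exists f, (fun e => (swap e, rev e)); split=> //; split=> // x.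
  have := fM x; case: x => [[e a] h].
  by rewrite /fibrewise /=; case: (arc_mate G _) => [[e' a'] h'] /= ->.
exists f, (fun e => (t e).1), (fun e => (t e).2); split=> // x.
have := fM x; case: x => [[e a] h].
by rewrite /fibrewise /=; case: (arc_mate G _) => [[e' a'] h'] /= ->.
Qed.

End Twist.

Lemma fibre_preserving (V V' : finType) (f : V -> V')
    (phi : half_edge V -> half_edge V') :
    injective phi -> (forall x, (phi x).1.1 = f x.1.1) ->
  exists sigma, (forall v, injective (sigma v)) /\ phi =1 fibrewise f sigma.
Proof.
move=> phi_inj phi1.
have phiE v p : phi (v, p.1, p.2)
    = (f v, (phi (v, p.1, p.2)).1.2, (phi (v, p.1, p.2)).2).
  by have := phi1 (v, p.1, p.2); case: (phi _) => [[v' i] j] /= ->.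
exists (fun v p => ((phi (v, p.1, p.2)).1.2, (phi (v, p.1, p.2)).2)).
split=> [v p q [E1 E2] | [[v i] j]]; last exact: (phiE v (i, j)).
have /phi_inj : phi (v, p.1, p.2) = phi (v, q.1, q.2).
  by rewrite phiE E1 E2 -phiE.
by case: p q {E1 E2} => [? ?] [? ?] [-> ->].
Qed.

Lemma fibrewise_inj (V V' : finType) (f : V -> V') sigma :
    injective f -> (forall v, injective (sigma v)) ->
  injective (fibrewise f sigma).
Proof.
move=> f_inj sigma_inj [[v i] j] [[v' i'] j'] [/f_inj <- E1 E2].
have /sigma_inj[-> ->] // : sigma v (i, j) = sigma v (i', j').
by rewrite [LHS]surjective_pairing [RHS]surjective_pairing E1 E2.
Qed.

Lemma op_act_inj o : injective (op_act o).
Proof. by case: o => -[[] []] [[] []]. Qed.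

Lemma word_act_inj w : injective (word_act w).
Proof. by elim: w => [|o w IHw] // p q /op_act_inj/IHw. Qed.

Lemma translate_inj t : injective (translate t).
Proof. by move=> [a b] [c d] [/addIb-> /addIb->]. Qed.

(** The permutations of the fibres induced by a half-edge isomorphism are split
    into words and translations.  The words define the twist, and the
    translations are what remains to be an isomorphism from the twist of [G]
    to [H]. *)
Lemma OrbP (E E' : finType) (G : arrow_presentation E)
    (H : arrow_presentation E') :
  Orb G H <-> half_edge_iso (medial G) (medial H).
Proof.
split=> [[w /ap_isoP[f [t [bf isoM]]]] | [f [phi [bf bphi phi1 phiM cGH]]]].
  have [phiM cGH] := carries_comp isoM (twist_carries w G).
  exists f, (fibrewise f (fun e => translate (t e))
             \o fibrewise id (fun e => word_act (w e))); split=> //.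
  apply: inj_card_bij; last by rewrite !card_prod (bij_eq_card bf).
  apply: inj_comp; apply: fibrewise_inj => //; first exact: bij_inj.
    by move=> v; exact: translate_inj.
  by move=> v; exact: word_act_inj.
have [sigma [sigma_inj phiE]] := fibre_preserving (bij_inj bphi) phi1.
have /fin_all_exists[w /fin_all_exists[t sigmaE]] :=
  fun e => perm_affine (sigma_inj e).
exists w; apply/ap_isoP; exists f, t; split=> //.
have [twistM cT] := twist_carries w G; split; last by rewrite -cT.
have twist_bij : bijective (fibrewise id (fun e => word_act (w e))).
  by apply: injF_bij; apply: fibrewise_inj => // e; exact: word_act_inj.
have [untwist _ untwistK] := twist_bij.
have phi_factor x : fibrewise f (fun e => translate (t e))
    (fibrewise id (fun e => word_act (w e)) x) = phi x.
  have /= -> := fibrewise_comp f id (fun e => translate (t e))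
                  (fun e => word_act (w e)) x.
  by rewrite phiE; apply: eq_fibrewise => v p; rewrite sigmaE.
by move=> y; rewrite -(untwistK y) -twistM !phi_factor; exact: phiM.
Qed.

Theorem theorem4p19 (E : finType) (G : arrow_presentation E) :
  (forall s : marked_graph_state E,
     graph_iso (underlying (medial (state_graph (medial G) s)))
               (underlying (medial G)))
  /\
  (forall (E' : finType) (H : arrow_presentation E'),
     Orb G H <-> graph_iso (underlying (medial H)) (underlying (medial G))).
Proof.
split=> [s | E' H]; first by apply/graph_isoP; exact: medial_state_graph.
split=> [/OrbP/half_edge_iso_sym iHG | /graph_isoP/half_edge_iso_sym iGH].
  exact/graph_isoP.
exact/OrbP.
Qed.
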